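(* Let $Q$ be a concave BUM function, let $\boldsymbol{c}^Q=(\rho_Q(C_1),\dots,\rho_Q(C_n))$ and $\eta=\sup_{t\in(0,1]}\frac{Q(t)}{t}$. If an optimal solution to the problem $\min_{\boldsymbol{x}\in\mathcal{X}}(\boldsymbol{c}^Q)^\top\boldsymbol{x}$ can be computed in polynomial time, then the problem $\min_{\boldsymbol{x}\in\mathcal{X}}\rho_Q(\boldsymbol{C}^\top\boldsymbol{x})$ is approximable within $\eta$. If additionally $C_i$, $i\in\{1,\dots,n\}$, have symmetric probability distributions, then $\min_{\boldsymbol{x}\in\mathcal{X}}\rho_Q(\boldsymbol{C}^\top\boldsymbol{x})$ is approximable within $\min\{2,\eta\}$.
   Context: A basic unit monotone (BUM) function is a function $Q:[0,1]\to[0,1]$ with $Q(0)=0$, $Q(1)=1$ and $Q(x)\ge Q(y)$ for $x>y$. For a random variable $Y$ with CDF $F_Y$, $\mathrm{VaR}_t(Y)=\inf\{y\in\mathbb{R}: F_Y(y)\ge t\}$ for $t\in(0,1]$ and $\mathrm{VaR}_0(Y)=\inf\{y\in\mathbb{R}:F_Y(y)>0\}$. Assumption (A1) on $Y$: $Y$ has bounded support and $t\mapsto \mathrm{VaR}_t(Y)$ is continuous on $[0,1]$. The distortion risk measure is the Riemann–Stieltjes integral $\rho_Q(Y)=\int_0^1 \mathrm{VaR}_{1-t}(Y)\,dQ(t)$. Setting: $\mathcal{X}\subseteq\mathbb{R}^n_+$ is a set of feasible solutions; $\boldsymbol{C}=(C_1,\dots,C_n)^\top$ is a nonnegative random cost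 vector whose components $C_i$ have bounded supports $[\underline{c}_i,\overline{c}_i]$; the random variables $\boldsymbol{C}^\top\boldsymbol{x}$, $\boldsymbol{x}\in\mathcal{X}$, and the $C_i$ satisfy (A1). A problem $\min_{\boldsymbol{x}\in\mathcal{X}}f(\boldsymbol{x})$ is approximable within $\kappa$ if there is a polynomial-time algorithm that outputs $\boldsymbol{x}^*\in\mathcal{X}$ with $f(\boldsymbol{x}^* )\le\kappa f(\boldsymbol{x})$ for all $\boldsymbol{x}\in\mathcal{X}$. (If $\eta=+\infty$, the bound $\eta$ is vacuous and $\min\{2,\eta\}=2$.) *)

(* Defs.v *)
From HB Require Import structures.
From mathcomp Require Import all_boot all_order all_algebra.
From mathcomp Require Import all_classical all_reals all_analysis.

Set Implicit Arguments.
Unset Strict Implicit.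
Unset Printing Implicit Defensive.

Import Order.TTheory GRing.Theory Num.Theory.
Import numFieldNormedType.Exports.

Local Open Scope classical_set_scope.
Local Open Scope ring_scope.

(* Only the restriction of Q to [0, 1] is constrained, and only that
   restriction is used below. *)
Definition BUM (R : realType) (Q : R -> R) : Prop :=
  [/\ forall t, 0 <= t <= 1 -> 0 <= Q t <= 1,
      Q 0 = 0,
      Q 1 = 1
    & forall x y, 0 <= x <= 1 -> 0 <= y <= 1 -> y < x -> Q y <= Q x].

Definition concave_on (R : realType) (D : set R) (Q : R -> R) : Prop :=
  @convex_function R R^o D (fun t => - Q t).

(* A tagged partition of [a, b] is a list s such that a :: s increases strictly
   from a to b, together with a tag xi k in each cell [F k, F k.+1]. *)
Definition tagged_partition (R : realType) (a b : R) (s : seq R)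
    (xi : nat -> R) : Prop :=
  let F := nth b (a :: s) in
  itv_partition a b s /\
  forall k, (k < size s)%N -> F k <= xi k <= F k.+1.

Definition finer_than (R : realType) (a b : R) (s : seq R) (delta : R) : Prop :=
  let F := nth b (a :: s) in
  forall k, (k < size s)%N -> F k.+1 - F k < delta.

Definition RS_sum (R : realType) (f g : R -> R) (a b : R) (s : seq R)
    (xi : nat -> R) : R :=
  let F := nth b (a :: s) in
  \sum_(0 <= k < size s) f (xi k) * (g (F k.+1) - g (F k)).

Definition is_RS_integral (R : realType) (f g : R -> R) (a b v : R) : Prop :=
  forall e, 0 < e -> exists2 delta, 0 < delta &
    forall s xi, tagged_partition a b s xi -> finer_than a b s delta ->
      `|RS_sum f g a b s xi - v| < e.

(* The Riemann-Stieltjes integral of f with respect to g over [a, b]; the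
   default value 0 is returned when it does not exist. *)
Definition RS_integral (R : realType) (f g : R -> R) (a b : R) : R :=
  xget 0 [set v | is_RS_integral f g a b v].

Section risk.
Context d (T : measurableType d) (R : realType) (P : probability T R).

(* Meant for t in [0, 1]. *)
Definition VaR (Y : {RV P >-> R}) (t : R) : R :=
  if t == 0 then inf [set y | (0 < cdf Y y)%E]
  else inf [set y | (t%:E <= cdf Y y)%E].

(* The topological support of the distribution of Y. *)
Definition rv_support (Y : {RV P >-> R}) : set R :=
  [set y | forall e : R, 0 < e -> (0 < distribution P Y (ball y e))%E].

Definition A1 (Y : {RV P >-> R}) : Prop :=
  bounded_set (rv_support Y) /\ {within `[0, 1], continuous (VaR Y)}.

Definition distortion_risk (Q : R -> R) (Y : {RV P >-> R}) : R :=
  RS_integral (fun t => VaR Y (1 - t)) Q 0 1.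

Definition symmetric_rv (Y : {RV P >-> R}) : Prop :=
  exists m : R, forall A : set R, measurable A ->
    P [set w | A (Y w - m)] = P [set w | A (m - Y w)].

Definition total_cost n (C : 'I_n -> {RV P >-> R}) (x : 'cV[R]_n) :
    {RV P >-> R} :=
  (\sum_i x i 0 *: (C i : {mfun T >-> R}))%R.

End risk.

(* Deterministic Turing machines with one two-way infinite tape. The tape
   alphabet consists of the blank None, the bits Some (inl b), and finitely many
   auxiliary symbols Some (inr a). The machine halts when tm_delta is None. *)
Inductive direction := MoveLeft | Stay | MoveRight.

Record turing_machine := TuringMachine {
  tm_state : finType;
  tm_aux : finType;
  tm_start : tm_state;
  tm_delta : tm_state -> option (bool + tm_aux) ->
             option (tm_state * option (bool + tm_aux) * direction) }.

Section machine.
Variable M : turing_machine.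

Notation symbol := (option (bool + tm_aux M)).

(* tm_left lists the symbols to the left of the head, nearest first; tm_right
   lists the scanned symbol and those to its right; other cells are blank. *)
Record tm_config := TmConfig {
  tm_current : tm_state M;
  tm_left : seq symbol;
  tm_right : seq symbol }.

Definition tm_init (w : seq bool) : tm_config :=
  TmConfig (tm_start M) [::] [seq Some (inl b) | b <- w].

Definition tm_step (c : tm_config) : option tm_config :=
  let r := behead (tm_right c) in
  match tm_delta (tm_current c) (head None (tm_right c)) with
  | None => None
  | Some (q, a, MoveLeft) =>
      Some (TmConfig q (behead (tm_left c)) [:: head None (tm_left c), a & r])
  | Some (q, a, Stay) => Some (TmConfig q (tm_left c) (a :: r))
  | Some (q, a, MoveRight) => Some (TmConfig q (a :: tm_left c) r)
  end.

(* The halting configuration if it is reached in at most t steps. *)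
Fixpoint tm_run (t : nat) (c : tm_config) : option tm_config :=
  match tm_step c, t with
  | None, _ => Some c
  | Some c', t'.+1 => tm_run t' c'
  | Some _, 0 => None
  end.

Fixpoint read_bits (s : seq symbol) : seq bool :=
  if s is Some (inl b) :: s' then b :: read_bits s' else [::].

(* The output is the maximal word of bits that starts at the head. *)
Definition tm_output (t : nat) (w : seq bool) : option (seq bool) :=
  omap (fun c => read_bits (tm_right c)) (tm_run t (tm_init w)).

End machine.

Record instance (R : realType) := Instance {
  dimension : nat;
  feasible : set 'cV[R]_dimension;
  display : measure_display;
  Omega : measurableType display;
  prob : probability Omega R;
  cost : 'I_dimension -> {RV prob >-> R} }.

Arguments feasible {R} i _.
Arguments prob {R} i.
Arguments cost {R} i _.

Definition admissible (R : realType) (I : instance R) : Prop :=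
  [/\ forall x, feasible I x -> forall i, 0 <= x i 0,
      {ae prob I, forall w, forall i, 0 <= cost I i w},
      forall i, exists lo hi : R, rv_support (cost I i) = `[lo, hi]%classic,
      forall i, A1 (cost I i)
    & forall x, feasible I x -> A1 (total_cost (cost I) x)].

(* A family of instances with an encoding of instances as input words and a
   decoding of output words as vectors (None on words that encode no vector). *)
Record problem (R : realType) := Problem {
  problem_index : Type;
  problem_instance : problem_index -> instance R;
  encode_instance : problem_index -> seq bool;
  decode_solution : forall k : problem_index,
    seq bool -> option 'cV[R]_(dimension (problem_instance k)) }.

Definition objective (R : realType) (p : problem R) :=
  forall k : problem_index p, 'cV[R]_(dimension (problem_instance k)) -> R.

(* Some polynomial-time algorithm outputs, for every instance k, a vector that
   satisfies the predicate [good k]. *)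
Definition polytime_finds (R : realType) (p : problem R)
    (good : forall k : problem_index p,
      'cV[R]_(dimension (problem_instance k)) -> Prop) : Prop :=
  exists (M : turing_machine) (q : {poly nat}), forall k,
    exists w x,
      [/\ tm_output M q.[size (encode_instance k)] (encode_instance k) = Some w,
          decode_solution k w = Some x
        & good k x].

Definition polytime_optimizable (R : realType) (p : problem R)
    (f : objective p) : Prop :=
  polytime_finds (fun k x => feasible (problem_instance k) x /\
    forall y, feasible (problem_instance k) y -> f k x <= f k y).

(* kappa = +oo stands for a vacuous bound; the guard is needed because
   +oo * 0 = 0 in \bar R. *)
Definition approximable (R : realType) (p : problem R) (f : objective p)
    (kappa : \bar R) : Prop :=
  polytime_finds (fun k x => feasible (problem_instance k) x /\
    forall y, feasible (problem_instance k) y ->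
      (kappa < +oo)%E -> ((f k x)%:E <= kappa * (f k y)%:E)%E).

Definition cQ (R : realType) (Q : R -> R) (I : instance R) :
    'cV[R]_(dimension I) :=
  \col_i distortion_risk Q (cost I i).

Definition linear_objective (R : realType) (Q : R -> R) (p : problem R) :
    objective p :=
  fun k x => ((cQ Q (problem_instance k))^T *m x) 0 0.

Definition risk_objective (R : realType) (Q : R -> R) (p : problem R) :
    objective p :=
  fun k x => distortion_risk Q (total_cost (cost (problem_instance k)) x).

Definition eta (R : realType) (Q : R -> R) : \bar R :=
  ereal_sup [set (Q t / t)%:E | t in `]0, 1]%classic].

(* Main.v *)
(* For concave [Q] the linear objective with costs [rho_Q(C_i)] dominates the
   risk objective, and each [rho_Q(C_i)] lies between the mean of [C_i] and
   [eta] times that mean. So for a minimizer x* of the linear objective and any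
   feasible y,
     rho(C x* ) <= sum_i x*_i rho(C_i) <= sum_i y_i rho(C_i)
                <= eta sum_i y_i E(C_i) = eta E(C y) <= eta rho(C y).
   A nonnegative C_i that is symmetric about its mean is at most twice its mean,
   whence rho(C_i) <= 2 E(C_i) and the factor 2.

   Everything about rho is read off the tail function
   T_a(Y) = min_z (a z + E (Y - z)^+), which is attained at the upper quantile
   of order a, so that its increments are bounded by quantiles. Hence rho(Y) is
   the limit of the sums of N (Q(t_{k+1}) - Q(t_k)) (T_{t_{k+1}} - T_{t_k}) over
   t_k = k / N. As the increments of Q decrease by concavity, Abel summation
   makes these sums monotone in T, and the inequalities T(sum_i x_i C_i) <=
   sum_i x_i T(C_i), a E(Y) <= T_a(Y) <= E(Y) (if Y >= 0) and T_a(Y) <= a h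
   (if Y <= h) all pass to rho. *)
Require Import Defs.
From mathcomp Require Import all_boot all_order all_algebra.
From mathcomp Require Import all_classical all_reals all_analysis.
From mathcomp Require Import measurable_realfun ring lra.

Set Implicit Arguments.
Unset Strict Implicit.
Unset Printing Implicit Defensive.

Import Order.TTheory GRing.Theory Num.Theory.
Import numFieldNormedType.Exports.

Local Open Scope classical_set_scope.
Local Open Scope ring_scope.

(** * Riemann-Stieltjes integrals of monotone functions *)

(** Heine-Cantor: compactness of the segment, in its near-covering form, makes the local radii
    uniform. *)
Lemma within_itv_unif_continuous (R : realType) (a b : R) (f : R -> R) :
  {within `[a, b], continuous f} ->
  forall e, 0 < e -> exists2 delta, 0 < delta &
    forall x y, x \in `[a, b] -> y \in `[a, b] -> `|x - y| < delta ->
      `|f x - f y| < e.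
Proof.
move=> /subspace_continuousP fc e e0.
have /compact_near_coveringP cov := @segment_compact R a b.
pose near_delta (delta x : R) := x \in `[a, b] -> forall y, y \in `[a, b] ->
  `|x - y| < delta -> `|f x - f y| < e.
have : \forall delta \near 0^'+, `[a, b] `<=` near_delta delta.
  apply: cov => x /= xab.
  have /cvgrPdist_lt/(_ (e / 2)) := fc x xab.
  rewrite divr_gt0// => /(_ isT); rewrite /within /=.
  move=> /nbhs_ballP[r /= r0 fr].
  exists (ball x (r / 2), [set delta | delta < r / 2]) => /=.
    split; first by apply: nbhsx_ballx; rewrite divr_gt0.
    by apply: nbhs_right_lt; rewrite divr_gt0.
  move=> [x' delta] /= [xx' dr] x'ab y yab x'y.
  rewrite /ball/= in xx' dr fr *.
  have fx' : `|f x - f x'| < e / 2.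
    by apply: fr => //; rewrite (lt_trans xx')// gtr_pMr// invf_lt1// ltr1n.
  have fy : `|f x - f y| < e / 2.
    apply: fr => //; rewrite (_ : x - y = (x - x') + (x' - y)); last by ring.
    rewrite (le_lt_trans (ler_normD _ _))// [ltRHS]splitr ltrD//.
    exact: lt_trans dr.
  rewrite (_ : f x' - f y = (f x - f y) - (f x - f x')); last by ring.
  by rewrite (le_lt_trans (ler_normB _ _))// [ltRHS]splitr ltrD.
move=> /nbhs_ballP[r /= r0 rP]; exists (r / 2); first by rewrite divr_gt0.
move=> x y xab yab xy; apply: (rP (r / 2)) => //; rewrite ?divr_gt0//.
rewrite /ball/= sub0r normrN gtr0_norm ?divr_gt0//.
by rewrite gtr_pMr// invf_lt1// ltr1n.
Qed.

Section riemann_stieltjes.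
Context (R : realType).
Implicit Types (f g : R -> R) (a b : R) (s : seq R).

Let clamp (l h x : R) := Num.max l (Num.min h x).

(* The variation of g over the intersection of [l, h] and [l', h']. *)
Let overlap g (l h l' h' : R) := g (clamp l h h') - g (clamp l h l').

(** For disjoint intervals the outer [max] collapses the difference to 0. This form is symmetric in
    the two intervals, which yields [overlapC]. *)
Let overlapE g l h l' h' : l <= h -> l' <= h' ->
  overlap g l h l' h' =
  g (Num.max (Num.max l l') (Num.min h h')) - g (Num.max l l').
Proof.
move=> lh lh'; rewrite /overlap /clamp.
have [hl'|] := boolP (h < l').
  rewrite (min_idPl (ltW hl')) (min_idPl (le_trans (ltW hl') lh')).
  rewrite (max_idPr lh) (max_idPr (le_trans lh (ltW hl'))).
  by rewrite (max_idPl (ltW hl')) !subrr.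
rewrite -leNgt => l'h; rewrite (min_idPr l'h); have [h'l|] := boolP (h' < l).
  have l'l := le_trans lh' (ltW h'l).
  rewrite (min_idPr (le_trans (ltW h'l) lh)) (max_idPl l'l).
  by rewrite (max_idPl (ltW h'l)) subrr.
rewrite -leNgt => lh''.
have -> : Num.max l (Num.min h h') = Num.min h h'.
  by rewrite (max_idPr _)// le_min lh lh''.
by rewrite (@max_idPr _ _ _ (Num.min h h') _)// ge_max !le_min lh lh'' l'h lh'.
Qed.

Let overlapC g l h l' h' : l <= h -> l' <= h' ->
  overlap g l h l' h' = overlap g l' h' l h.
Proof.
by move=> lh lh'; rewrite !overlapE// (maxC l') (minC h').
Qed.

Let sum_overlap g l h (v : nat -> R) n a b : l <= h -> a <= l -> h <= b ->
  v 0%N = a -> v n = b ->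
  \sum_(0 <= j < n) overlap g l h (v j) (v j.+1) = g h - g l.
Proof.
move=> lh al hb v0 vn.
rewrite (telescope_sumr (fun j => g (clamp l h (v j))))// v0 vn /clamp.
by rewrite (min_idPl hb) (max_idPr lh) (min_idPr (le_trans al lh)) (max_idPl al).
Qed.

Definition lower_sum f g (u : nat -> R) n :=
  \sum_(0 <= k < n) f (u k.+1) * (g (u k.+1) - g (u k)).

Definition upper_sum f g (u : nat -> R) n :=
  \sum_(0 <= k < n) f (u k) * (g (u k.+1) - g (u k)).

(** The conditions bear on every index, even beyond [n]: [nth b (a :: s)] stays at [b] past its end,
    so no index bound has to be carried along. *)
Let is_subdivision a b (u : nat -> R) n :=
  [/\ u 0%N = a, u n = b, forall k, a <= u k <= b & forall k, u k <= u k.+1].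

(** Replaces a common refinement: each increment of [g] is split over the cells of the other
    subdivision, and the double sums are compared termwise. A nonzero term forces [v j <= u k.+1],
    hence [f (u k.+1) <= f (v j)]. *)
Let lower_le_upper_sum f g a b (u v : nat -> R) m n :
  {in `[a, b] &, nonincreasing_fun f} -> {in `[a, b] &, nondecreasing_fun g} ->
  is_subdivision a b u m -> is_subdivision a b v n ->
  lower_sum f g u m <= upper_sum f g v n.
Proof.
move=> fni gnd [u0 um uab und] [v0 vn vab vnd].
have uE k : g (u k.+1) - g (u k) =
    \sum_(0 <= j < n) overlap g (u k) (u k.+1) (v j) (v j.+1).
  by rewrite (sum_overlap g _ _ _ v0 vn)//; have /andP[] := uab k;
    have /andP[] := uab k.+1.
have vE j : g (v j.+1) - g (v j) =
    \sum_(0 <= k < m) overlap g (u k) (u k.+1) (v j) (v j.+1).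
  under eq_bigr do rewrite overlapC//.
  by rewrite (sum_overlap g _ _ _ u0 um)//; have /andP[] := vab j;
    have /andP[] := vab j.+1.
rewrite /lower_sum /upper_sum.
under eq_bigr do rewrite uE big_distrr/=.
under [leRHS]eq_bigr do rewrite vE big_distrr/=.
rewrite exchange_big/=; apply: ler_sum => j _; apply: ler_sum => k _.
have /andP[auk ukb] := uab k; have /andP[auk1 uk1b] := uab k.+1.
have /andP[avj vjb] := vab j; have /andP[avj1 vj1b] := vab j.+1.
rewrite overlapE//; have [uv|] := boolP (u k.+1 < v j).
  rewrite (max_idPr (le_trans (und _) (ltW uv))).
  by rewrite (min_idPl (ltW (lt_le_trans uv (vnd _)))) (max_idPl (ltW uv)) subrr !mulr0.
rewrite -leNgt => vu.
rewrite ler_wpM2r//.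
  rewrite subr_ge0; apply: gnd; last by rewrite le_max lexx.
    by rewrite in_itv/= le_max ge_max ?avj ?auk ?ukb ?vjb ?uk1b.
  by rewrite in_itv/= !le_max !ge_max ge_min ?avj ?auk ?ukb ?vjb ?uk1b.
by apply: fni; rewrite ?in_itv/= ?avj ?auk1 ?vjb ?uk1b.
Qed.

Let partition_subdivision a b s : itv_partition a b s ->
  is_subdivision a b (nth b (a :: s)) (size s).
Proof.
move=> abs; split => //.
- by rewrite (itv_partition_nth_size b abs).
- move=> k; have [ks|sk] := ltnP k (size s).+1.
    by rewrite itv_partition_nth_ge ?itv_partition_nth_le.
  by rewrite nth_default ?lexx ?(itv_partition_le abs).
- move=> k; have [ks|sk] := ltnP k (size s).
    by apply: (@nondecreasing_fun_itv_partition _ _ a b id s).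
  rewrite [leRHS]nth_default//.
  move: sk; rewrite leq_eqVlt => /predU1P[<-|sk]; last by rewrite nth_default.
  by rewrite (itv_partition_nth_size b abs).
Qed.

Lemma RS_sum_between f g a b s xi :
  {in `[a, b] &, nonincreasing_fun f} -> {in `[a, b] &, nondecreasing_fun g} ->
  tagged_partition a b s xi ->
  lower_sum f g (nth b (a :: s)) (size s) <= RS_sum f g a b s xi
    <= upper_sum f g (nth b (a :: s)) (size s).
Proof.
move=> fni gnd [abs tags]; have [_ _ Fab Fnd] := partition_subdivision abs.
apply/andP; split; rewrite /RS_sum /lower_sum /upper_sum big_nat [leRHS]big_nat;
  apply: ler_sum => k /andP[_ ks];
  have /andP[Fx xF] := tags _ ks;
  have /andP[aF Fb] := Fab k; have /andP[aF1 F1b] := Fab k.+1;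
  (apply: ler_wpM2r; [rewrite subr_ge0; apply: gnd | apply: fni]) => //;
  rewrite in_itv/= ?aF ?aF1//; lra.
Qed.

(** The integral is the supremum of the lower sums; uniform continuity of [f] brings upper and lower
    sums of fine partitions together. *)
Lemma is_RS_integral_exists f g a b : a <= b ->
  {in `[a, b] &, nonincreasing_fun f} -> {in `[a, b] &, nondecreasing_fun g} ->
  {within `[a, b], continuous f} ->
  exists v, is_RS_integral f g a b v.
Proof.
move=> ab fni gnd fc.
pose S := [set r | exists2 s, itv_partition a b s &
  r = lower_sum f g (nth b (a :: s)) (size s)].
have [s0 s0P] : exists s, itv_partition a b s.
  move: ab; rewrite le_eqVlt => /predU1P[<-|ab]; first by exists [::].
  by exists [:: b]; exact: itv_partition1.
have S_le s : itv_partition a b s ->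
    ubound S (upper_sum f g (nth b (a :: s)) (size s)).
  move=> abs _ [s' abs' ->]; apply: lower_le_upper_sum fni gnd _ _ => //;
    exact: partition_subdivision.
have supS : has_sup S by split; [exists (lower_sum f g (nth b (a :: s0)) (size s0)), s0|
  exists (upper_sum f g (nth b (a :: s0)) (size s0)); exact: S_le].
exists (sup S) => e e0.
have gab : 0 <= g b - g a.
  by rewrite subr_ge0; apply: gnd; rewrite ?in_itv/= ?lexx ?ab.
set c := g b - g a in gab *.
(* Adding 1 keeps the denominator positive when [c = 0]. *)
have c0 : 0 < e / (c + 1) by rewrite divr_gt0//; lra.
have [delta d0 deltaP] := within_itv_unif_continuous fc c0.
exists delta => // s xi tp fine_s; have [abs _] := tp.
have [F0 Fm Fab Fnd] := partition_subdivision abs.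
have /andP[lowS Supp] := RS_sum_between fni gnd tp.
have low_sup : lower_sum f g (nth b (a :: s)) (size s) <= sup S.
  by apply: sup_upper_bound => //; exists s.
have sup_upp : sup S <= upper_sum f g (nth b (a :: s)) (size s).
  by apply: ge_sup; [case: supS | exact: S_le].
have gap : upper_sum f g (nth b (a :: s)) (size s)
    - lower_sum f g (nth b (a :: s)) (size s)
    <= e / (c + 1) * c.
  rewrite /upper_sum /lower_sum -sumrB.
  have dgE : \sum_(0 <= k < size s) (g (nth b (a :: s) k.+1)
      - g (nth b (a :: s) k)) = c.
    by rewrite (telescope_sumr (g \o nth b (a :: s)))//= Fm.
  rewrite -[X in _ <= _ * X]dgE mulr_sumr big_nat [leRHS]big_nat.
  apply: ler_sum => k /andP[_ ks].
  have /andP[aF Fb] := Fab k; have /andP[aF1 F1b] := Fab k.+1.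
  rewrite -mulrBl ler_wpM2r//.
    by rewrite subr_ge0; apply: gnd; rewrite ?in_itv/= ?aF ?aF1.
  apply/ltW; apply: le_lt_trans (ler_norm _) _; apply: deltaP;
    rewrite ?in_itv/= ?aF ?aF1//.
  by rewrite distrC ger0_norm ?subr_ge0//; exact: fine_s.
have gap_lt : e / (c + 1) * c < e.
  by rewrite -mulrA gtr_pMr// mulrC ltr_pdivrMr ?mul1r; lra.
by rewrite ltr_norml; apply/andP; split; lra.
Qed.

Lemma RS_integralP f g a b : (exists v, is_RS_integral f g a b v) ->
  is_RS_integral f g a b (RS_integral f g a b).
Proof. by move=> ?; exact: xgetPex. Qed.

End riemann_stieltjes.

(** * Almost surely bounded random variables *)

Section expectation_ae.
Context d (T : measurableType d) (R : realType) (P : probability T R).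
Implicit Types (f g : T -> R) (Y : {RV P >-> R}).

Definition ae_bounded f := exists M : R, \forall w \ae P, `|f w| <= M.

Lemma ae_bounded_integrable f : measurable_fun setT f -> ae_bounded f ->
  P.-integrable setT (EFin \o f).
Proof.
move=> mf [M fM]; apply/integrableP; split; first exact/measurable_EFinP.
apply: (@le_lt_trans _ _ (\int[P]_w (`|M|)%:E)%E).
  apply: ae_ge0_le_integral => //.
    by apply/measurable_EFinP; exact: measurableT_comp.
  by apply: filterS fM => w fwM _; rewrite lee_fin (le_trans fwM)// ler_norm.
by rewrite integral_cst// [X in (_ * X)%E](probability_setT P) mule1 ltry.
Qed.

Lemma Rintegral_prob_cst (c : R) : \int[P]_w c = c.
Proof.
rewrite Rintegral_cst// [X in fine X](_ : _ = 1%E) ?mulr1//.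
exact: probability_setT.
Qed.

(** [g - f] agrees almost everywhere with its positive part, whose integral is nonnegative. *)
Lemma ae_le_Rintegral f g :
  P.-integrable setT (EFin \o f) -> P.-integrable setT (EFin \o g) ->
  (\forall w \ae P, f w <= g w) -> \int[P]_w f w <= \int[P]_w g w.
Proof.
move=> intf intg fg; rewrite -subr_ge0 -RintegralB// /Rintegral.
have mfT h : P.-integrable setT (EFin \o h) -> measurable_fun setT h.
  by case/integrableP => /measurable_EFinP.
have mgf := measurable_funB (mfT _ intg) (mfT _ intf).
rewrite (@ae_eq_integral _ _ _ P setT (fun w => (Num.max (g w - f w) 0)%:E))//.
- by apply: fine_ge0; apply: integral_ge0 => w _; rewrite lee_fin le_max lexx orbT.
- exact/measurable_EFinP.
- by apply/measurable_EFinP; exact: measurable_maxr.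
- by apply: filterS fg => w fgw _; rewrite (max_idPl _)// subr_ge0.
Qed.

Lemma Rintegral_sum (I : Type) (r : seq I) (F : I -> T -> R) :
  (forall i, P.-integrable setT (EFin \o F i)) ->
  P.-integrable setT (EFin \o (fun w => \sum_(i <- r) F i w)) /\
  \int[P]_w (\sum_(i <- r) F i w) = \sum_(i <- r) \int[P]_w F i w.
Proof.
move=> intF; elim: r => [|i r [intr IH]].
  under eq_fun do rewrite big_nil.
  rewrite big_nil; split; last by rewrite Rintegral_cst// mul0r.
  exact: integrable0.
have E : (fun w => \sum_(i0 <- i :: r) F i0 w) =
    (fun w => F i w + \sum_(i <- r) F i w).
  by apply/funext => w; rewrite big_cons.
split; first by rewrite E; exact: (integrableD measurableT (intF i) intr).
by rewrite E big_cons RintegralD// IH.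
Qed.

(** Each point outside the support lies in a null ball with rational centre and radius
    [1 / (n + 1)], and there are countably many such balls. *)
Lemma negligible_rv_support_compl Y :
  P.-negligible (Y @^-1` (~` rv_support Y)).
Proof.
pose B (k : nat) : set R :=
  if @unpickle (rat * nat)%type k is Some (q, n)
  then ball (ratr q : R) (n : nat).+1%:R^-1
  else set0.
pose F k := if distribution P Y (B k) == 0%E then Y @^-1` B k else set0.
have mB k : measurable (B k).
  by rewrite /B; case: unpickle => // -[q n]; exact: measurable_ball.
apply: (@negligibleS _ _ _ _ (\bigcup_k F k)); last first.
  apply: negligible_bigcup => k; rewrite /F; case: eqP => [B0|_].
    by apply/negligibleP => //; rewrite -[X in measurable X]setTI; exact: measurable_funP.
  exact: negligible_set0.
move=> w /= /existsNP[e /not_implyP[e0 /negP]].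
rewrite -leNgt => De.
(* A radius below [e / 2] keeps every ball that contains [Y w] inside [ball (Y w) e]. *)
have [n _ ne] := near_infty_natSinv_lt (PosNum (divr_gt0 e0 (@ltr0Sn R 1))).
have {}ne := ne n (leqnn n); rewrite /= in ne.
have [r nr] : exists r : R, n.+1%:R^-1 = r by eexists.
have r0 : 0 < r by rewrite -nr invr_gt0.
rewrite nr in ne; have [q] : exists q, ratr q \in `](Y w - r), (Y w + r)[.
  by have /rat_in_itvoo : Y w - r < Y w + r by lra.
rewrite in_itv/= => /andP[qY Yq].
have qw : ball (ratr q : R) r (Y w).
  by rewrite /ball/= ltr_norml; apply/andP; split; lra.
exists (pickle (q, n)) => //; rewrite /F /B pickleK nr ifT//.
rewrite -measure_le0 (le_trans _ De)// le_measure ?inE//;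
  [exact: measurable_ball|exact: measurable_ball|].
move=> y; rewrite /ball/= => qy; move: qw; rewrite /ball/= => qw.
rewrite (_ : Y w - y = (ratr q - y) - (ratr q - Y w)); last by ring.
by rewrite (le_lt_trans (ler_normB _ _))//; lra.
Qed.

Lemma ae_bounded_rv Y : bounded_set (rv_support Y) -> ae_bounded Y.
Proof.
move=> [M [_ MY]]; exists (M + 1).
apply: negligibleS (negligible_rv_support_compl Y) => w /=; apply: contra_not.
by move=> Yw; apply: (MY (M + 1)) => //; rewrite ltrDl.
Qed.

Lemma distribution_eq0 Y (A : set R) : measurable A ->
  (\forall w \ae P, ~ A (Y w)) -> distribution P Y A = 0%E.
Proof.
move=> mA nA; apply: (@measure_negligible _ _ _ P (Y @^-1` A)).
  by rewrite -[X in measurable X]setTI; exact: measurable_funP.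
by apply: negligibleS nA => w /= Aw; exact.
Qed.

End expectation_ae.

(** * Value-at-risk and tail function *)

Section value_at_risk.
Context d (T : measurableType d) (R : realType) (P : probability T R).
Variable Y : {RV P >-> R}.
Hypothesis Ybnd : ae_bounded P Y.

Let level (t : R) := if t == 0 then [set y | (0 < cdf Y y)%E]
  else [set y | (t%:E <= cdf Y y)%E].

Let VaRE t : VaR Y t = inf (level t).
Proof. by rewrite /VaR /level; case: ifP. Qed.

(** With [lt_level], this places [level t] between the conditions [t < cdf Y y] and [t <= cdf Y y],
    so the quantile inequalities treat order 0 like any other. *)
Let level_le t y : level t y -> (t%:E <= cdf Y y)%E.
Proof. by rewrite /level; case: eqP => [->/ltW|_]. Qed.

Let lt_level (t y : R) : 0 <= t -> (t%:E < cdf Y y)%E -> level t y.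
Proof. by rewrite /level; case: eqP => [->|_ _ /ltW]. Qed.

Let level_has_inf (t : R) : 0 <= t <= 1 -> has_inf (level t).
Proof.
move=> /andP[t0 t1]; have [M YM] := Ybnd; split.
  have YM1 : cdf Y M = 1%E.
    rewrite cdf_1_ccdf (_ : ccdf Y M = 0%E) ?sube0//.
    apply: distribution_eq0 => //; apply: filterS YM => w YM.
    by rewrite /= in_itv/= andbT; apply/negP; rewrite -leNgt (le_trans (ler_norm _)).
  by exists M; rewrite /level; case: eqP => _; rewrite /= YM1 ?lte01 ?lee_fin.
(* The distribution function vanishes below [- M]; at order 0 the strict inequality in [VaR]
   excludes such points. *)
exists (- M) => y Ly; rewrite leNgt; apply/negP => yM.
have : cdf Y y = 0%E.
  apply: distribution_eq0 => //; apply: filterS YM => w; rewrite ler_norml /=.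
  by rewrite in_itv/= => /andP[MY _]; apply/negP; rewrite -ltNge (lt_le_trans yM).
move: Ly; rewrite /level; case: eqP => [_|/eqP t_neq0] /= + Y0; rewrite Y0 ?ltxx//.
by rewrite lee_fin leNgt lt_neqAle eq_sym t_neq0 t0.
Qed.

Lemma cdf_le_of_lt_VaR t y : 0 <= t <= 1 -> y < VaR Y t -> (cdf Y y <= t%:E)%E.
Proof.
move=> t01; rewrite VaRE => yV; rewrite leNgt; apply/negP => ty.
have /andP[t0 _] := t01.
have := ge_inf (level_has_inf t01).2 (lt_level t0 ty).
by rewrite leNgt yV.
Qed.

Lemma le_cdf_of_VaR_lt t y : 0 <= t <= 1 -> VaR Y t < y -> (t%:E <= cdf Y y)%E.
Proof.
move=> t01; rewrite VaRE => /(inf_lt (level_has_inf t01).1)[z Lz zy].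
by rewrite (le_trans (level_le Lz))// cdf_nondecreasing// ltW.
Qed.

Lemma VaR_nondecreasing : {in `[0, 1] &, nondecreasing_fun (VaR Y)}.
Proof.
move=> s t; rewrite !in_itv/= => s01 t01; rewrite le_eqVlt => /predU1P[->//|st].
rewrite leNgt; apply/negP => /midf_lt[ty ys].
have := le_cdf_of_VaR_lt t01 ty; apply/negP; rewrite -ltNge.
by rewrite (le_lt_trans (cdf_le_of_lt_VaR s01 ys)).
Qed.

(** The stop-loss transform of [Y]. *)
Definition excess (z : R) := \int[P]_w Num.max (Y w - z) 0.

Let mexcess z : measurable_fun setT (fun w => Num.max (Y w - z) 0).
Proof. by apply: measurable_maxr => //; exact: measurable_funB. Qed.

Lemma integrable_excess z :
  P.-integrable setT (EFin \o (fun w => Num.max (Y w - z) 0)).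
Proof.
apply: ae_bounded_integrable => //; have [M YM] := Ybnd.
exists (M + `|z|); apply: filterS YM => w YM.
rewrite ger0_norm ?le_max ?lexx ?orbT// ge_max.
have := ler_norm (Y w); have := ler_norm (- z); rewrite normrN.
have := normr_ge0 (Y w); have := normr_ge0 z.
by move=> *; apply/andP; split; lra.
Qed.

Let exceed (r : R) := Y @^-1` `]r, +oo[.

Let measurable_exceed r : measurable (exceed r).
Proof. by rewrite -[X in measurable X]setTI; exact: measurable_funP. Qed.

Let integrable_step (r : R) : P.-integrable setT (EFin \o \1_(exceed r)).
Proof.
apply: ae_bounded_integrable; first exact: measurable_indic.
by exists 1; apply: aeW => w; rewrite indicE; case: (_ \in _); rewrite ?normr0 ?normr1.
Qed.

Let Rintegral_step (r : R) :
  \int[P]_w (\1_(exceed r) w : R) = 1 - fine (cdf Y r).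
Proof.
rewrite /Rintegral integral_indic// setIT [X in fine X](_ : _ = ccdf Y r)//.
by rewrite ccdf_1_cdf fineB// fin_num_measure.
Qed.

Let indic_exceed r w : \1_(exceed r) w = (r < Y w)%R%:R :> R.
Proof.
rewrite indicE; congr (_ %:R); congr nat_of_bool.
by apply/idP/idP; rewrite inE /exceed /= in_itv/= andbT.
Qed.

(** The difference of the positive parts lies pointwise between [z' - z] times the indicator of
    [Y > z'] and [z' - z] times that of [Y > z]. *)
Lemma excess_diff (z z' : R) : z <= z' ->
  (z' - z) * (1 - fine (cdf Y z')) <= excess z - excess z' <=
  (z' - z) * (1 - fine (cdf Y z)).
Proof.
move=> zz'; rewrite -!Rintegral_step /excess -RintegralB ?(integrable_excess _)//.
rewrite -!RintegralZl//.
have intB : P.-integrable setT (EFin \o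
    (fun w => Num.max (Y w - z) 0 - Num.max (Y w - z') 0)).
  exact: integrableB (integrable_excess z) (integrable_excess z').
have intZ r : P.-integrable setT (EFin \o (fun w => (z' - z) * \1_(exceed r) w)).
  exact: (integrableZl measurableT (z' - z) (integrable_step r)).
apply/andP; split; apply: le_Rintegral => // w _; rewrite indic_exceed;
  case: ltP => Yw; rewrite /= ?mulr0 ?mulr1;
  case: (leP (Y w - z) 0) => ?; case: (leP (Y w - z') 0) => ?; lra.
Qed.

Lemma excess_nonincreasing : nonincreasing_fun excess.
Proof.
move=> z z' zz'; rewrite -subr_ge0.
have /andP[+ _] := excess_diff zz'; apply: le_trans; rewrite mulr_ge0 ?subr_ge0//.
by rewrite -lee_fin fineK ?fin_num_measure ?cdf_le1.
Qed.

Lemma excess_ge0 z : 0 <= excess z.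
Proof. by apply: Rintegral_ge0 => w _; rewrite le_max lexx orbT. Qed.

Lemma excess_lipschitz (z z' : R) : z <= z' -> excess z - excess z' <= z' - z.
Proof.
move=> zz'; have /andP[_ /le_trans] := excess_diff zz'; apply.
by rewrite ler_piMr ?subr_ge0// gerBl fine_ge0.
Qed.

(* Rockafellar-Uryasev: [a z + E (Y - z)^+] is minimal at the upper quantile of
   order [a], and its minimum is the integral of the upper quantiles of order
   less than [a], i.e. [a] times the conditional value-at-risk. *)
Definition tail (a : R) := a * VaR Y (1 - a) + excess (VaR Y (1 - a)).

(** The convex function [a * z + excess z] has right slope [cdf Y z - (1 - a)], which is nonpositive
    left of the quantile and nonnegative right of it. *)
Lemma tail_le a z : 0 <= a <= 1 -> tail a <= a * z + excess z.
Proof.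
move=> /andP[a0 a1]; have t01 : 0 <= 1 - a <= 1 by lra.
rewrite /tail; set z0 := VaR Y (1 - a); apply/ler_addgt0Pr => e e0.
have [zz0|z0z|->] := ltgtP z z0; last by lra.
(* The bound on the distribution function holds only strictly left of the quantile, so the
   comparison stops within [e] of it; the remaining gap costs at most [a * e <= e]. *)
- pose z' := Num.max z (z0 - e); have zz' : z <= z' by rewrite le_max lexx.
  have z'z0 : z' < z0 by rewrite gt_max zz0 ltrBlDr ltrDl.
  have Fa : fine (cdf Y z') <= 1 - a.
    rewrite -lee_fin fineK ?fin_num_measure//.
    exact: cdf_le_of_lt_VaR.
  have /andP[diff _] := excess_diff zz'.
  have := excess_nonincreasing (ltW z'z0).
  have z'e : z0 - e <= z' by rewrite le_max lexx orbT.
  have : a * (z' - z) <= (z' - z) * (1 - fine (cdf Y z')).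
    by rewrite mulrC ler_wpM2l ?subr_ge0//; lra.
  have : a * (z0 - z') <= 1 * e by apply: ler_pM; lra.
  lra.
(* On this side the remaining gap costs at most [e] because [excess] is 1-Lipschitz. *)
- pose z' := Num.min z (z0 + e); have z'z : z' <= z by rewrite ge_min lexx.
  have z0z' : z0 < z' by rewrite lt_min z0z ltrDl.
  have Fa : 1 - a <= fine (cdf Y z').
    rewrite -lee_fin fineK ?fin_num_measure//.
    exact: le_cdf_of_VaR_lt.
  have /andP[_ diff] := excess_diff z'z.
  have := excess_lipschitz (ltW z0z').
  have z'e : z' <= z0 + e by rewrite ge_min lexx orbT.
  have : (z - z') * (1 - fine (cdf Y z')) <= a * (z - z').
    by rewrite mulrC ler_wpM2r ?subr_ge0//; lra.
  have : 0 <= a * (z' - z0) by apply: mulr_ge0; lra.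
  lra.
Qed.

(** Envelope argument: the minimizer of each order is tested in the objective of the other, and the
    [excess] terms cancel. *)
Lemma tail_diff (a b : R) : 0 <= a -> a <= b -> b <= 1 ->
  (b - a) * VaR Y (1 - b) <= tail b - tail a <= (b - a) * VaR Y (1 - a).
Proof.
move=> a0 ab b1; have a01 : 0 <= a <= 1 by lra.
have b01 : 0 <= b <= 1 by lra.
have := tail_le (VaR Y (1 - b)) a01; have := tail_le (VaR Y (1 - a)) b01.
rewrite /tail; move: (VaR Y (1 - a)) (VaR Y (1 - b)) => za zb.
by move: (excess za) (excess zb) => ea eb *; lra.
Qed.

Lemma excess_eq0 z : (\forall w \ae P, Y w <= z) -> excess z = 0.
Proof.
move=> Yz; apply/eqP; rewrite eq_le excess_ge0 andbT.
rewrite -[leRHS](Rintegral_prob_cst P).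
apply: ae_le_Rintegral => //; [exact: integrable_excess|exact: integrable0|].
by apply: filterS Yz => w Yw; rewrite ge_max lexx subr_le0 Yw.
Qed.

Lemma tail0 : tail 0 = 0.
Proof.
apply/eqP; rewrite eq_le; apply/andP; split; last first.
  by rewrite /tail mul0r add0r excess_ge0.
have [M YM] := Ybnd; have a01 : 0 <= (0 : R) <= 1 by rewrite lexx ler01.
rewrite (le_trans (tail_le M a01))// mul0r add0r excess_eq0//.
by apply: filterS YM => w; exact/le_trans/ler_norm.
Qed.

Let integrable_rv : P.-integrable setT (EFin \o Y).
Proof. exact: ae_bounded_integrable. Qed.

(** Multiply [E Y - z <= excess z] by [a], then use [a * excess z <= excess z]. *)
Lemma mean_le_tail a : 0 <= a <= 1 -> a * \int[P]_w Y w <= tail a.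
Proof.
move=> a01; rewrite /tail; set z := VaR Y (1 - a).
have intc : P.-integrable setT (EFin \o (fun=> z)).
  by apply: ae_bounded_integrable => //; exists `|z|; exact: aeW.
have : \int[P]_w (Y w - z) <= excess z.
  apply: le_Rintegral => //;
    [exact: integrableB integrable_rv intc|exact: integrable_excess|].
  by move=> w _; rewrite le_max lexx.
rewrite RintegralB// Rintegral_prob_cst.
move=> meanz; have /andP[a0 a1] := a01.
have := ler_wpM2l a0 meanz; have := ler_wpM2r (excess_ge0 z) a1.
by move: (excess z) (\int[P]_w Y w) => *; lra.
Qed.

Lemma tail_le_mean a : 0 <= a <= 1 -> (\forall w \ae P, 0 <= Y w) ->
  tail a <= \int[P]_w Y w.
Proof.
move=> a01 Y0; rewrite (le_trans (tail_le 0 a01))// mulr0 add0r.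
apply: ae_le_Rintegral => //; first exact: integrable_excess.
by apply: filterS Y0 => w Yw; rewrite subr0 ge_max lexx.
Qed.

Lemma tail_le_ubound a h : 0 <= a <= 1 -> (\forall w \ae P, Y w <= h) ->
  tail a <= a * h.
Proof.
by move=> a01 Yh; rewrite (le_trans (tail_le h a01))// excess_eq0// addr0.
Qed.

End value_at_risk.

(** * Nonnegative combinations of costs *)

Section total_cost.
Context d (T : measurableType d) (R : realType) (P : probability T R).
Variables (n : nat) (C : 'I_n -> {RV P >-> R}) (x : 'cV[R]_n).
Hypothesis Cbnd : forall i, ae_bounded P (C i).

Lemma total_costE w : total_cost C x w = \sum_i x i 0 * C i w.
Proof. by rewrite /total_cost mfun_sum. Qed.

Lemma mean_total_cost :
  \int[P]_w total_cost C x w = \sum_i x i 0 * \int[P]_w C i w.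
Proof.
have intC i : P.-integrable setT (EFin \o C i) by exact: ae_bounded_integrable.
have intxC i : P.-integrable setT (EFin \o (fun w => x i 0 * C i w)).
  exact: (integrableZl measurableT (x i 0) (intC i)).
under eq_Rintegral do rewrite total_costE.
have [_ ->] := Rintegral_sum (index_enum 'I_n) intxC.
by apply: eq_bigr => i _; rewrite RintegralZl.
Qed.

(** The combination of the quantiles of the [C i] serves as candidate in the minimum for the total
    cost; the positive part is subadditive. *)
Lemma tail_total_cost a : ae_bounded P (total_cost C x) ->
  (forall i, 0 <= x i 0) -> 0 <= a <= 1 ->
  tail (total_cost C x) a <= \sum_i x i 0 * tail (C i) a.
Proof.
move=> Sbnd x0 a01; pose z i := VaR (C i) (1 - a).
rewrite (le_trans (tail_le Sbnd (\sum_i x i 0 * z i) a01))//.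
under [leRHS]eq_bigr do rewrite /tail mulrDr mulrCA.
rewrite big_split/= -mulr_sumr lerD2l.
have intxC i : P.-integrable setT
    (EFin \o (fun w => x i 0 * Num.max (C i w - z i) 0)).
  exact: (integrableZl measurableT (x i 0) (integrable_excess (Cbnd i) _)).
have [intS eqS] := Rintegral_sum (index_enum 'I_n) intxC.
have -> : \sum_i x i 0 * excess (C i) (z i) =
    \int[P]_w \sum_i x i 0 * Num.max (C i w - z i) 0.
  rewrite eqS; apply: eq_bigr => i _; rewrite RintegralZl//.
  exact: integrable_excess.
apply: le_Rintegral => //; first exact: integrable_excess.
move=> w _; rewrite total_costE -sumrB ge_max; apply/andP; split.
  by apply: ler_sum => i _; rewrite -mulrBr ler_wpM2l// le_max lexx.
by apply: sumr_ge0 => i _; rewrite mulr_ge0// le_max lexx orbT.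
Qed.

End total_cost.

(** * Symmetric distributions *)

Section symmetric.
Context d (T : measurableType d) (R : realType) (P : probability T R).

(** The centre of symmetry [m] is the mean, and [P (Y - m > m) = P (m - Y > m) = P (Y < 0) = 0]. *)
Lemma symmetric_rv_le_mean (Y : {RV P >-> R}) : ae_bounded P Y ->
  (\forall w \ae P, 0 <= Y w) -> symmetric_rv Y ->
  \forall w \ae P, Y w <= 2 * \int[P]_w Y w.
Proof.
move=> Ybnd Y0 [m sym].
have intY : P.-integrable setT (EFin \o Y) by exact: ae_bounded_integrable.
have intm : P.-integrable setT (EFin \o (fun=> m)).
  by apply: ae_bounded_integrable => //; exists `|m|; exact: aeW.
have mean : \int[P]_w Y w = m.
  have mU : measurable_fun setT (fun w => Y w - m) by exact: measurable_funB.
  have mV : measurable_fun setT (fun w => m - Y w) by exact: measurable_funB.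
  have intU : P.-integrable setT (EFin \o (fun w => Y w - m)).
    exact: integrableB intY intm.
  have intV : P.-integrable setT (EFin \o (fun w => m - Y w)).
    exact: integrableB intm intY.
  (* Symmetry says that [Y - m] and [m - Y] have the same image measure, hence the same integral. *)
  have UV : (\int[P]_w (Y w - m)%:E = \int[P]_w (m - Y w)%:E)%E.
    rewrite -(@integral_pushforward _ _ _ _ _ _ mU P setT EFin) ?preimage_setT//.
    rewrite -(@integral_pushforward _ _ _ _ _ _ mV P setT EFin) ?preimage_setT//.
    apply: eq_measure_integral => A mA _; exact: sym.
  have := congr1 fine UV.
  rewrite -/(Rintegral _ _ _) -/(Rintegral P setT (fun w => m - Y w)).
  by rewrite !RintegralB// !Rintegral_prob_cst => ?; lra.
rewrite mean.
have mS (f : T -> R) : measurable_fun setT f ->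
    measurable [set w | `]m, +oo[%classic (f w)].
  by move=> mf; rewrite -[X in measurable X]setTI; apply: mf.
suff : P.-negligible [set w | ~ Y w <= 2 * m] by [].
exists [set w | `]m, +oo[%classic (Y w - m)]; split.
- by apply: mS; exact: measurable_funB.
- rewrite sym//; apply: measure_negligible.
    by apply: mS; exact: measurable_funB.
  by apply: negligibleS Y0 => w /=; rewrite in_itv/= andbT => mY; apply/negP; lra.
- by move=> w /= /negP; rewrite -ltNge in_itv/= andbT; lra.
Qed.

End symmetric.

(** * Distortion risk measures *)

Lemma sum_nonincreasing_increments_ge0 (R : realDomainType) (q w : nat -> R) n :
  w 0%N = 0 -> (forall k, (k.+1 < n)%N -> q k.+1 <= q k) ->
  (forall k, (k < n)%N -> 0 <= q k) -> (forall k, (k <= n)%N -> 0 <= w k) ->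
  0 <= \sum_(0 <= k < n) q k * (w k.+1 - w k).
Proof.
case: n => [|n] w0 qni q0 w_ge0; first by rewrite big_nil.
(* The induction needs this stronger lower bound in place of 0. *)
apply: (@le_trans _ _ (q n * w n.+1)); first by rewrite mulr_ge0 ?q0 ?w_ge0.
elim: n qni {q0} w_ge0 => [|n IH] qni w_ge0.
  by rewrite big_nat1 w0 subr0.
rewrite big_nat_recr//= [leRHS]addrC -lerBlDl.
apply: le_trans (IH (fun k kn => qni k (ltnW kn)) (fun k kn => w_ge0 k (leqW kn))).
by rewrite mulrBr opprB addrC subrK ler_wpM2r ?qni ?w_ge0.
Qed.

Section distortion.
Context (R : realType) (Q : R -> R).
Hypotheses (Q_bum : BUM Q) (Q_concave : concave_on `[0, 1] Q).

Let grid (N k : nat) : R := k%:R / N%:R.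

Let grid01 N k : (k <= N)%N -> 0 <= grid N k <= 1.
Proof.
move=> kN; rewrite /grid divr_ge0//=; case: N kN => [|N] kN.
  by rewrite invr0 mulr0.
by rewrite ler_pdivrMr ?mul1r ?ler_nat.
Qed.

Let gridS N k : (k.+1 <= N)%N -> grid N k.+1 = grid N k + N%:R^-1.
Proof. by move=> _; rewrite /grid -[in LHS]addn1 natrD mulrDl mul1r. Qed.

Let Q_nd : {in `[0, 1] &, nondecreasing_fun Q}.
Proof.
move=> s t; rewrite !in_itv/= => s01 t01; rewrite le_eqVlt => /predU1P[->//|].
by have [_ _ _ Qle] := Q_bum; exact: Qle.
Qed.

Let dQ N k := Q (grid N k.+1) - Q (grid N k).

Let dQ_ge0 N k : (k < N)%N -> 0 <= dQ N k.
Proof.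
move=> kN; rewrite subr_ge0; apply: Q_nd; rewrite ?in_itv/= ?grid01// 1?ltnW//.
by rewrite gridS// lerDl invr_ge0.
Qed.

(** Concavity at weight 1/2, since [grid N k.+1] is the midpoint of its two neighbours. *)
Let dQ_nonincreasing N k : (k.+1 < N)%N -> dQ N k.+1 <= dQ N k.
Proof.
move=> kN; have h01 : 0 <= (2^-1 : R) <= 1 by lra.
have midE : 2^-1 * grid N k + (1 - 2^-1) * grid N k.+2 = grid N k.+1.
  by rewrite !gridS ?(ltnW kN)//; lra.
have := Q_concave (Itv01 (andP h01).1 (andP h01).2)
  (mem_set (grid01 (ltnW (ltnW kN)))) (mem_set (grid01 kN)).
rewrite convRE /= [X in - Q X <= _](_ : _ = grid N k.+1); last exact: midE.
rewrite /dQ /unstable.onem; lra.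
Qed.

(* [tail_sum N (tail Y)] is squeezed between the lower and the upper
   Riemann-Stieltjes sum of [distortion_risk Q Y] for the uniform partition. *)
Definition tail_sum (N : nat) (T : R -> R) :=
  \sum_(0 <= k < N) dQ N k * (N%:R * T (grid N k.+1) - N%:R * T (grid N k)).

(** Abel summation for [N * (T' - T)] on the grid; agreement at 0 makes its initial value vanish. *)
Lemma tail_sum_le N (T T' : R -> R) : T 0 = T' 0 ->
  (forall a, 0 <= a <= 1 -> T a <= T' a) -> tail_sum N T <= tail_sum N T'.
Proof.
move=> T0 TT'; rewrite -subr_ge0 -sumrB.
have -> : \sum_(0 <= k < N)
    (dQ N k * (N%:R * T' (grid N k.+1) - N%:R * T' (grid N k)) -
     dQ N k * (N%:R * T (grid N k.+1) - N%:R * T (grid N k))) =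
  \sum_(0 <= k < N) dQ N k * (N%:R * (T' (grid N k.+1) - T (grid N k.+1)) -
    N%:R * (T' (grid N k) - T (grid N k))).
  by apply: eq_bigr => k _; ring.
apply: (@sum_nonincreasing_increments_ge0 _ (dQ N)
  (fun k => N%:R * (T' (grid N k) - T (grid N k)))) => [|k|k|k kN].
- by rewrite /grid mul0r T0 subrr mulr0.
- exact: dQ_nonincreasing.
- exact: dQ_ge0.
- by rewrite mulr_ge0// subr_ge0 TT'// grid01.
Qed.

Lemma tail_sum_lincomb N n (x : 'I_n -> R) (T : 'I_n -> R -> R) :
  tail_sum N (fun a => \sum_i x i * T i a) = \sum_i x i * tail_sum N (T i).
Proof.
rewrite /tail_sum; under [RHS]eq_bigr do rewrite mulr_sumr.
rewrite exchange_big/=; apply: eq_bigr => k _.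
rewrite !mulr_sumr -sumrB mulr_sumr; apply: eq_bigr => i _; ring.
Qed.

(** [a * c] is the tail function of the constant [c]; it is compared with [tail Y] to bound the risk
    by the mean from below and by an upper bound of [Y] from above. *)
Lemma tail_sum_linear N c : (0 < N)%N -> tail_sum N (fun a => a * c) = c.
Proof.
move=> N0; have N_neq0 : N%:R != 0 :> R by rewrite pnatr_eq0 -lt0n.
transitivity (\sum_(0 <= k < N) dQ N k * c).
  apply: eq_big_nat => k /andP[_ kN]; congr (_ * _).
  by rewrite -mulrBr -mulrBl gridS// addrAC subrr add0r mulrA divff ?mul1r.
rewrite -mulr_suml (telescope_sumr (fun k => Q (grid N k)))//.
have [_ Q0 Q1 _] := Q_bum.
by rewrite /grid divff// mul0r Q0 Q1 subr0 mul1r.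
Qed.

(** Only the first cell sees the jump at 0, which produces the quotient [Q t / t] at
    [t = 1 / (N + 1)]. *)
Lemma tail_sum_cst N c :
  tail_sum N.+1 (fun a => if a == 0 then 0 else c) =
  Q N.+1%:R^-1 / N.+1%:R^-1 * c.
Proof.
rewrite /tail_sum big_nat_recl//= big1_seq ?addr0; last first.
  move=> k _; rewrite ifF; last by rewrite mulf_eq0 invr_eq0 !pnatr_eq0.
  by rewrite ifF ?subrr ?mulr0// mulf_eq0 invr_eq0 !pnatr_eq0.
have [_ Q0 _ _] := Q_bum.
rewrite /dQ /grid !mul0r eqxx Q0 mulr0 !subr0 mul1r invrK mulrA ifF//.
by rewrite invr_eq0 pnatr_eq0.
Qed.

Section rv.
Context d (T : measurableType d) (P : probability T R) (Y : {RV P >-> R}).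
Hypotheses (Ybnd : ae_bounded P Y) (Y_A1 : A1 Y).

Let f t := VaR Y (1 - t).

Let fni : {in `[0, 1] &, nonincreasing_fun f}.
Proof.
move=> s t; rewrite !in_itv/= => s01 t01 st.
apply: (VaR_nondecreasing Ybnd); rewrite ?in_itv/=; lra.
Qed.

Let fc : {within `[0, 1], continuous f}.
Proof.
have [_ /subspace_continuousP Vc] := Y_A1.
apply/subspace_continuousP => t /= t01.
have u01 : `[0, 1]%classic (1 - t) by move: t01; rewrite /= !in_itv/=; lra.
apply/cvgrPdist_lt => e e0; have /cvgrPdist_lt/(_ e e0) := Vc _ u01.
rewrite /within /= => /nbhs_ballP[r /= r0 near_u].
apply/nbhs_ballP; exists r => // s ts s01; apply: near_u.
  by rewrite /ball/= opprB addrC addrA addrNK distrC.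
by move: s01; rewrite /= !in_itv/=; lra.
Qed.

Lemma distortion_riskP : is_RS_integral f Q 0 1 (distortion_risk Q Y).
Proof. by apply: RS_integralP; exact: is_RS_integral_exists. Qed.

Lemma cvg_tail_sum :
  tail_sum n.+1 (tail Y) @[n --> \oo] --> distortion_risk Q Y.
Proof.
apply/cvgrPdist_lt => e e0.
have [delta d0 RS] := distortion_riskP e0.
have [n0 _ nd] := near_infty_natSinv_lt (PosNum d0).
exists n0 => // n /= /nd /= {}nd.
(* Partitions are read from [0 :: s], so [s] starts at grid index 1. *)
pose s := [seq grid n.+1 k.+1 | k <- iota 0 n.+1].
have size_s : size s = n.+1 by rewrite size_map size_iota.
have sE k : (k <= n.+1)%N -> nth 1 (0 :: s) k = grid n.+1 k.
  case: k => [|k] kn; first by rewrite /grid mul0r.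
  by rewrite [LHS]/= (nth_map 0%N) ?size_iota// nth_iota.
have gridSn k : (k < n.+1)%N -> grid n.+1 k.+1 = grid n.+1 k + n.+1%:R^-1.
  exact: gridS.
have ninv0 : 0 < n.+1%:R^-1 :> R by rewrite invr_gt0.
have s_part : itv_partition 0 1 s.
  split; last by rewrite (last_nth 1) size_s sE// /grid divff// pnatr_eq0.
  apply/(pathP 1) => k; rewrite size_s => kn.
  have := sE _ kn; rewrite /= => ->.
  by rewrite (sE _ (ltnW kn)) gridSn// ltrDl.
have s_fine : finer_than 0 1 s delta.
  move=> k; rewrite size_s => kn.
  by rewrite !sE ?(ltnW kn)// gridSn// addrAC subrr add0r.
have tag xi : (forall k, (k < n.+1)%N -> grid n.+1 k <= xi k <= grid n.+1 k.+1) ->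
    tagged_partition 0 1 s xi.
  by move=> xiP; split=> // k; rewrite size_s => kn; rewrite !sE ?(ltnW kn)// xiP.
have RS_sE xi : RS_sum f Q 0 1 s xi = \sum_(0 <= k < n.+1) f (xi k) * dQ n.+1 k.
  rewrite /RS_sum size_s; apply: eq_big_nat => k /andP[_ kn].
  by rewrite !sE ?(ltnW kn).
(* As [f] is nonincreasing, right-end tags give the lower sum and left-end tags the upper one. *)
have lowP : `|RS_sum f Q 0 1 s (fun k => grid n.+1 k.+1) - distortion_risk Q Y| < e.
  by apply: RS => //; apply: tag => k kn; rewrite lexx gridSn// lerDl ltW.
have uppP : `|RS_sum f Q 0 1 s (grid n.+1) - distortion_risk Q Y| < e.
  by apply: RS => //; apply: tag => k kn; rewrite lexx gridSn// lerDl ltW.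
have tailP k : (k < n.+1)%N ->
    f (grid n.+1 k.+1) <= n.+1%:R * tail Y (grid n.+1 k.+1) -
      n.+1%:R * tail Y (grid n.+1 k) <= f (grid n.+1 k).
  move=> kn; have /andP[g0 _] := grid01 (ltnW kn); have /andP[_ g1] := grid01 kn.
  have gle : grid n.+1 k <= grid n.+1 k.+1 by rewrite gridSn// lerDl ltW.
  have := tail_diff Ybnd g0 gle g1; rewrite -/(f _) -/(f _).
  have -> : grid n.+1 k.+1 - grid n.+1 k = n.+1%:R^-1.
    by rewrite gridSn// addrAC subrr add0r.
  by rewrite -mulrBr ![n.+1%:R^-1 * _]mulrC ler_pdivrMr// ler_pdivlMr// mulrC.
have low_le : RS_sum f Q 0 1 s (fun k => grid n.+1 k.+1) <= tail_sum n.+1 (tail Y).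
  rewrite RS_sE; apply: ler_sum_nat => k /andP[_ kn]; rewrite mulrC.
  by rewrite ler_wpM2l ?dQ_ge0//; have /andP[] := tailP k kn.
have le_upp : tail_sum n.+1 (tail Y) <= RS_sum f Q 0 1 s (grid n.+1).
  rewrite RS_sE; apply: ler_sum_nat => k /andP[_ kn]; rewrite [leRHS]mulrC.
  by rewrite ler_wpM2l ?dQ_ge0//; have /andP[] := tailP k kn.
move: lowP uppP low_le le_upp; move: (RS_sum _ _ _ _ _ _) (RS_sum _ _ _ _ _ _).
move: (tail_sum _ _) (distortion_risk _ _) => t v l u.
by rewrite !ltr_norml => /andP[? ?] /andP[? ?] *; apply/andP; split; lra.
Qed.

End rv.
End distortion.

(** * Bounds on the risk obtained as limits of tail sums *)

Section distortion_bounds.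
Context (R : realType) (Q : R -> R).
Hypotheses (Q_bum : BUM Q) (Q_concave : concave_on `[0, 1] Q).
Context d (T : measurableType d) (P : probability T R).
Implicit Types Y : {RV P >-> R}.

Lemma distortion_risk_total_cost n (C : 'I_n -> {RV P >-> R}) (x : 'cV[R]_n) :
  (forall i, A1 (C i)) -> A1 (total_cost C x) -> (forall i, 0 <= x i 0) ->
  distortion_risk Q (total_cost C x) <= \sum_i x i 0 * distortion_risk Q (C i).
Proof.
move=> CA1 SA1 x0.
have Cbnd i : ae_bounded P (C i) := ae_bounded_rv (CA1 i).1.
have Sbnd : ae_bounded P (total_cost C x) := ae_bounded_rv SA1.1.
apply: (@ler_cvg_to _ \oo _ _ (fun n => tail_sum Q n.+1 (tail (total_cost C x)))
  (fun n => \sum_i x i 0 * tail_sum Q n.+1 (tail (C i)))).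
- exact: cvg_tail_sum.
- apply: cvg_big => [|i _]; first exact: add_continuous.
  by apply: cvgM; [exact: cvg_cst|exact: cvg_tail_sum].
near=> N; rewrite -tail_sum_lincomb.
apply: tail_sum_le => // [|a a01]; last exact: tail_total_cost.
by rewrite tail0// big1// => i _; rewrite tail0// mulr0.
Unshelve. all: by end_near. Qed.

Lemma mean_le_distortion_risk Y : A1 Y ->
  \int[P]_w Y w <= distortion_risk Q Y.
Proof.
move=> YA1; have Ybnd : ae_bounded P Y := ae_bounded_rv YA1.1.
apply: (@ler_cvg_to _ \oo _ _ (fun n => \int[P]_w Y w)
  (fun n => tail_sum Q n.+1 (tail Y))); [exact: cvg_cst|exact: cvg_tail_sum|].
near=> N; rewrite -[leLHS](tail_sum_linear Q_bum _ (ltn0Sn N)).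
apply: tail_sum_le => // [|a a01]; last exact: mean_le_tail.
by rewrite mul0r tail0.
Unshelve. all: by end_near. Qed.

Lemma distortion_risk_le_ubound Y h : A1 Y -> (\forall w \ae P, Y w <= h) ->
  distortion_risk Q Y <= h.
Proof.
move=> YA1 Yh; have Ybnd : ae_bounded P Y := ae_bounded_rv YA1.1.
apply: (@ler_cvg_to _ \oo _ _ (fun n => tail_sum Q n.+1 (tail Y))
  (fun n => h)); [exact: cvg_tail_sum|exact: cvg_cst|].
near=> N; rewrite -[leRHS](tail_sum_linear Q_bum _ (ltn0Sn N)).
apply: tail_sum_le => // [|a a01]; last exact: tail_le_ubound.
by rewrite mul0r tail0.
Unshelve. all: by end_near. Qed.

(** The tail is compared with the step function that is 0 at 0 and the mean elsewhere, whose tail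
    sums involve only one value of [Q t / t]. *)
Lemma distortion_risk_le_mean Y (r : R) : A1 Y -> (\forall w \ae P, 0 <= Y w) ->
  (forall t, 0 < t <= 1 -> Q t / t <= r) ->
  distortion_risk Q Y <= r * \int[P]_w Y w.
Proof.
move=> YA1 Y0 Qr; have Ybnd : ae_bounded P Y := ae_bounded_rv YA1.1.
have mean0 : 0 <= \int[P]_w Y w.
  by rewrite -[leLHS](tail0 Ybnd) tail_le_mean// lexx ler01.
apply: (@ler_cvg_to _ \oo _ _ (fun n => tail_sum Q n.+1 (tail Y))
  (fun n => r * \int[P]_w Y w)); [exact: cvg_tail_sum|exact: cvg_cst|].
near=> N.
apply: (@le_trans _ _ (Q N.+1%:R^-1 / N.+1%:R^-1 * \int[P]_w Y w)); last first.
  by rewrite ler_wpM2r// Qr// invr_gt0 ltr0Sn/= invf_le1// ler1n.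
rewrite -tail_sum_cst//; apply: tail_sum_le => // [|a a01].
  by rewrite eqxx tail0.
by case: eqP => [->|_]; [rewrite tail0|exact: tail_le_mean].
Unshelve. all: by end_near. Qed.

End distortion_bounds.

(** * Approximation guarantee and transfer of the algorithm *)

Section approximation.
Context (R : realType) (Q : R -> R) (I : instance R).
Hypotheses (Q_bum : BUM Q) (Q_concave : concave_on `[0, 1] Q)
  (I_admissible : admissible I).

Let linear (x : 'cV[R]_(dimension I)) := ((cQ Q I)^T *m x) 0 0.
Let risk x := distortion_risk Q (total_cost (cost I) x).
Let mean i := \int[prob I]_w cost I i w.

Lemma cost_ge0 i : \forall w \ae prob I, 0 <= cost I i w.
Proof. by have [_ C0 _ _ _] := I_admissible; apply: filterS C0 => w. Qed.

(** The factor [r] stays abstract so that one chain of inequalities serves both [eta] and 2. *)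
Lemma linear_minimizer_approx (r : R) x y : 0 <= r ->
  (forall i, distortion_risk Q (cost I i) <= r * mean i) ->
  feasible I x -> feasible I y -> linear x <= linear y ->
  risk x <= r * risk y.
Proof.
move=> r0 Cr Xx Xy xy; have [X0 _ _ CA1 SA1] := I_admissible.
have linearE z : linear z = \sum_i z i 0 * distortion_risk Q (cost I i).
  rewrite /linear mxE; apply: eq_bigr => i _.
  by rewrite !mxE mulrC.
apply: (@le_trans _ _ (linear x)).
  rewrite linearE; apply: distortion_risk_total_cost => //; first exact: SA1.
  exact: X0.
apply: (le_trans xy).
apply: (@le_trans _ _ (\sum_i y i 0 * (r * mean i))).
  by rewrite linearE; apply: ler_sum => i _; rewrite ler_wpM2l ?X0.
under eq_bigr do rewrite mulrCA.
rewrite -mulr_sumr ler_wpM2l//.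
have Cbnd i : ae_bounded (prob I) (cost I i) := ae_bounded_rv (CA1 i).1.
rewrite -mean_total_cost//; apply: mean_le_distortion_risk => //; exact: SA1.
Qed.

End approximation.

(** Take [t = 1]. This rules out [-oo] and makes multiplication by [eta Q] monotone. *)
Lemma eta_ge1 (R : realType) (Q : R -> R) : BUM Q -> (1 <= eta Q)%E.
Proof.
move=> [_ _ Q1 _]; apply: ereal_sup_ubound; exists 1.
  by rewrite /= in_itv/= ltr01 lexx.
by rewrite Q1 divr1.
Qed.

(** The same machine and time bound are reused; only the guarantee on the output changes. *)
Lemma approximable_of_linear (R : realType) (Q : R -> R) (p : problem R)
    (kappa : \bar R) :
  BUM Q -> concave_on `[0, 1] Q ->
  (forall k : problem_index p, admissible (problem_instance k)) ->
  polytime_optimizable (@linear_objective R Q p) ->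
  (0 <= kappa)%E ->
  (forall r, kappa = r%:E -> forall (k : problem_index p) i,
    distortion_risk Q (cost (problem_instance k) i) <=
    r * \int[prob (problem_instance k)]_w cost (problem_instance k) i w) ->
  approximable (@risk_objective R Q p) kappa.
Proof.
move=> Q_bum Q_concave adm [M [q Mq]] kappa0 kP; exists M, q => k.
have [w [x [out dec [Xx x_opt]]]] := Mq k; exists w, x; split => //; split => // y Xy.
(* The value [+oo] is discharged by the guard in [approximable], and [-oo] by [kappa0]. *)
case: kappa kappa0 kP => [r||] // r0 /(_ r erefl) Cr _.
rewrite -EFinM lee_fin; rewrite lee_fin in r0.
exact: (linear_minimizer_approx Q_bum Q_concave (adm k) r0 (Cr k) Xx Xy (x_opt y Xy)).
Qed.

Theorem theorem2 (R : realType) (Q : R -> R) (p : problem R)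
  (Q_bum : BUM Q) (Q_concave : concave_on `[0, 1] Q)
  (p_admissible : forall k : problem_index p, admissible (problem_instance k))
  (linear_polytime : polytime_optimizable (@linear_objective R Q p)) :
  approximable (@risk_objective R Q p) (eta Q) /\
  ((forall (k : problem_index p) (i : 'I_(dimension (problem_instance k))),
      symmetric_rv (cost (problem_instance k) i)) ->
   approximable (@risk_objective R Q p) (Order.min 2%:E (eta Q))%E).
Proof.
have eta0 : (0 <= eta Q)%E := le_trans lee01 (eta_ge1 Q_bum).
have etaP r : eta Q = r%:E -> forall (k : problem_index p) i,
    distortion_risk Q (cost (problem_instance k) i) <=
    r * \int[prob (problem_instance k)]_w cost (problem_instance k) i w.
  move=> etaE k i; have [_ _ _ CA1 _] := p_admissible k.
  apply: distortion_risk_le_mean => // [|t t01]; first exact: cost_ge0.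
  by rewrite -lee_fin -etaE; apply: ereal_sup_ubound; exists t; rewrite //= in_itv.
split; first exact: approximable_of_linear.
move=> sym; have [_|_] := leP 2%:E (eta Q); last exact: approximable_of_linear.
apply: approximable_of_linear => // _ [<-] k i.
have [_ _ _ CA1 _] := p_admissible k.
(* Twice the mean is an almost sure upper bound of a symmetric nonnegative cost, hence bounds its
   risk. *)
apply: distortion_risk_le_ubound => //; apply: symmetric_rv_le_mean => //.
- exact: (ae_bounded_rv (CA1 i).1).
- exact: cost_ge0.
Qed.
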